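(* Let $G$ be a graph of order $n_0$ and size $m_0$, and let $k\ge 1$. Suppose $\mathcal{L}^k(G)$ has property $\varrho$ and the multiplicity of $-2$ as an eigenvalue of $\mathcal{L}^k(G)$ is $m_{k-1}-n_{k-1}$. Then $\overline{\mathcal{L}^k(G)}$ has exactly two positive eigenvalues, namely its spectral radius $\overline{\lambda}_{k(1)}$ and the eigenvalue $1$ with multiplicity $m_{k-1}-n_{k-1}$, and $$\mathcal{E}\big(\overline{\mathcal{L}^k(G)}\big)=2\overline{\lambda}_{k(1)}+\frac{\mathcal{E}(\mathcal{L}^k(G))}{2}.$$
   Context: $\mathcal{L}^k(G)$ is the $k$-th iterated line graph ($\mathcal{L}^0(G)=G$, $\mathcal{L}^k(G)=\mathcal{L}(\mathcal{L}^{k-1}(G))$), with order $n_k$ and size $m_k$; $\overline{X}$ is the complement of $X$. A graph has property $\varrho$ if all its negative adjacency eigenvalues equal $-2$. $\overline{\lambda}_{k(1)}$ is the largest adjacency eigenvalue of $\overline{\mathcal{L}^k(G)}$. Energy $\mathcal{E}$ is the sum of absolute values of adjacency eigenvalues.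
   Formalization: Positive eigenvalues are given as the multiset of the spectral radius plus 1 repeated m_{k-1}-n_{k-1} times; the radius may itself equal 1 (as for G=K_4, k=1, where ''exactly two'' fails literally). The k-th line graph is assumed to have at least one vertex. *)

(* Defs.v *)
From HB Require Import structures.
From mathcomp Require Import all_boot all_order all_algebra.
From mathcomp Require Import polyrcf.

Set Implicit Arguments.
Unset Strict Implicit.
Unset Printing Implicit Defensive.

Import Order.TTheory GRing.Theory Num.Theory.
Local Open Scope ring_scope.

Record sgraph := SGraph {
  vertex : finType;
  adj : rel vertex;
  adj_sym : symmetric adj;
  adj_irrefl : irreflexive adj }.

Definition edges (G : sgraph) : {set {set vertex G}} :=
  [set [set p.1; p.2] | p : vertex G * vertex G & adj p.1 p.2].

Definition graph_order (G : sgraph) : nat := #|vertex G|.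
Definition graph_size (G : sgraph) : nat := #|edges G|.

Section Complement.
Variable G : sgraph.
Definition compl_adj : rel (vertex G) := fun x y => (x != y) && ~~ adj x y.
Lemma compl_adj_sym : symmetric compl_adj.
Proof. by move=> x y; rewrite /compl_adj eq_sym adj_sym. Qed.
Lemma compl_adj_irrefl : irreflexive compl_adj.
Proof. by move=> x; rewrite /compl_adj eqxx. Qed.
Definition complement : sgraph := SGraph compl_adj_sym compl_adj_irrefl.
End Complement.

Section LineGraph.
Variable G : sgraph.
Definition edge_type : finType := {e : {set vertex G} | e \in edges G}.
Definition line_adj : rel edge_type :=
  fun e f => (e != f) && (val e :&: val f != set0).
Lemma line_adj_sym : symmetric line_adj.
Proof. by move=> e f; rewrite /line_adj eq_sym setIC. Qed.
Lemma line_adj_irrefl : irreflexive line_adj.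
Proof. by move=> e; rewrite /line_adj eqxx. Qed.
Definition line_graph : sgraph := SGraph line_adj_sym line_adj_irrefl.
End LineGraph.

Definition iter_line (k : nat) (G : sgraph) : sgraph := iter k line_graph G.

Section Spectrum.
Variables (R : rcfType) (G : sgraph).

Definition adjmx : 'M[R]_#|vertex G| :=
  \matrix_(i, j) (adj (enum_val i) (enum_val j))%:R.

Definition eig_mult (x : R) : nat := mup x (char_poly adjmx).

(* The adjacency eigenvalues lambda_1 >= lambda_2 >= ..., each repeated       *)
(* according to its multiplicity. [rootsR p] lists the distinct roots of p    *)
(* in R once each; since adjmx is symmetric, its characteristic polynomial    *)
(* splits over R, so no eigenvalue is missed.                                 *)
Definition spectrum : seq R :=
  sort >=%R (flatten [seq nseq (eig_mult x) x | x <- rootsR (char_poly adjmx)]).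

(* The default 0 is reached only by the graph with no vertices. *)
Definition largest_eig : R := head 0 spectrum.

Definition spectral_radius : R := \big[Num.max/0]_(x <- spectrum) `|x|.

Definition energy : R := \sum_(x <- spectrum) `|x|.

Definition property_rho : Prop :=
  forall x : R, eigenvalue adjmx x -> x < 0 -> x = - 2.

End Spectrum.

(* Main.v *)
(** Write L for the k-th iterated line graph, m for its order, J for the
    all-ones matrix, and d for the multiplicity of -2 in L, so that d is the
    difference of size and order of the previous iterate F.  If N is the
    edge-vertex incidence matrix of F then A(L) + 2 = N N^T, hence a
    (-2)-eigenvector x satisfies x N = 0 and has coordinate sum 0; since
    A(complement L) = J - 1 - A(L), it is a 1-eigenvector of the complement.
    On the (m - d)-dimensional sum of the other eigenspaces A(L) is positive
    semidefinite, so intersecting with the hyperplane orthogonal to the all-ones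
    vector yields m - d - 1 eigenvalues of the complement that are at most -1.
    Finally, for a (-2)-eigenvector x, the vector |x| has Rayleigh quotient at
    least 1 and is not orthogonal to the all-ones vector, so the form of the
    complement dominates the Euclidean norm on a space of dimension d + 1, and
    exactly d + 1 eigenvalues are at least 1.  The energies follow because both
    traces vanish. *)
Require Import Defs.
From mathcomp Require Import all_boot all_order all_algebra.
From mathcomp Require Import complex polyrcf spectral ring lra zify.
Set Implicit Arguments.
Unset Strict Implicit.
Unset Printing Implicit Defensive.
Import Order.TTheory GRing.Theory Num.Theory.
Local Open Scope ring_scope.

(** * Orthogonal diagonalisation of symmetric matrices over a real closed field *)

Section RealSpectral.
Variable R : rcfType.

Definition dot n (u v : 'rV[R]_n) : R := (u *m v^T) 0 0.

Lemma dotE n (u v : 'rV[R]_n) : dot u v = \sum_i u 0 i * v 0 i.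
Proof. by rewrite /dot mxE; apply: eq_bigr => i _; rewrite mxE. Qed.

Lemma dotC n (u v : 'rV[R]_n) : dot u v = dot v u.
Proof. by rewrite !dotE; apply: eq_bigr => i _; rewrite mulrC. Qed.

Lemma dotDl n (u v w : 'rV[R]_n) : dot (u + v) w = dot u w + dot v w.
Proof. by rewrite /dot mulmxDl mxE. Qed.

Lemma dotZl n a (u v : 'rV[R]_n) : dot (a *: u) v = a * dot u v.
Proof. by rewrite /dot -scalemxAl mxE. Qed.

Lemma dotDr n (u v w : 'rV[R]_n) : dot u (v + w) = dot u v + dot u w.
Proof. by rewrite dotC dotDl !(dotC _ u). Qed.

Lemma dotZr n a (u v : 'rV[R]_n) : dot u (a *: v) = a * dot u v.
Proof. by rewrite dotC dotZl dotC. Qed.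

Lemma dotBl n (u v w : 'rV[R]_n) : dot (u - v) w = dot u w - dot v w.
Proof. by rewrite /dot mulmxBl !mxE. Qed.

Lemma dot_ge0 n (u : 'rV[R]_n) : 0 <= dot u u.
Proof. by rewrite dotE sumr_ge0 // => i _; rewrite -expr2 sqr_ge0. Qed.

Lemma dot_eq0 n (u : 'rV[R]_n) : (dot u u == 0) = (u == 0).
Proof.
apply/eqP/eqP=> [|->]; last by rewrite /dot mul0mx mxE.
rewrite dotE => /eqP; rewrite psumr_eq0 => [/allP u0|i _]; last first.
  by rewrite -expr2 sqr_ge0.
apply/rowP=> i; rewrite mxE; apply/eqP; rewrite -(sqrf_eq0 (u 0 i)) expr2.
by have := u0 i (mem_index_enum i).
Qed.

Lemma dot_gt0 n (u : 'rV[R]_n) : u != 0 -> 0 < dot u u.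
Proof. by move=> u0; rewrite lt_def dot_eq0 u0 dot_ge0. Qed.

Lemma dot_mulmx_sym n (A : 'M[R]_n) (u v : 'rV[R]_n) :
  A^T = A -> dot (u *m A) v = dot (v *m A) u.
Proof.
move=> sA; rewrite [RHS]dotC /dot trmx_mul sA.
by rewrite mulmxA.
Qed.

Lemma mul_row_trmx n (u v : 'rV[R]_n) : u *m v^T = (dot u v)%:M.
Proof. exact: mx11_scalar. Qed.

(* The imaginary part of a complex eigenvalue vanishes, so the real and       *)
(* imaginary parts of an eigenvector are real eigenvectors.                   *)
Lemma symmx_eigenvector n (A : 'M[R]_n.+1) : A^T = A ->
  exists (a : R) (v : 'rV[R]_n.+1), v != 0 /\ v *m A = a *: v.
Proof.
move=> sA; pose toC := real_complex R.
have [[a b] /eigenvalueP[z zA z0]] :=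
  eigenvalue_closed (map_mx toC A) (ltn0Sn n).
pose x := map_mx (@complex.Re R) z; pose y := map_mx (@complex.Im R) z.
have ReIm_sum (F : 'I_n.+1 -> R[i]) :
    (complex.Re (\sum_i F i) = \sum_i complex.Re (F i)) *
    (complex.Im (\sum_i F i) = \sum_i complex.Im (F i)).
  elim/big_rec3: _ => // i p q r _; case: (F i) => s t.
  by case: r => s' t' /= [-> ->].
have xA : x *m A = a *: x - b *: y.
  apply/rowP=> j.
  have /(congr1 (@complex.Re R)) := congr1 (fun M : 'rV_n.+1 => M 0 j) zA.
  rewrite !mxE ReIm_sum => E.
  transitivity (\sum_i complex.Re (z 0 i * map_mx toC A i j)).
    apply: eq_bigr => i _; rewrite !mxE /toC; case: (z 0 i) => s t /=.
    by rewrite mulr0 subr0.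
  by rewrite E; case: (z 0 j).
have yA : y *m A = b *: x + a *: y.
  apply/rowP=> j.
  have /(congr1 (@complex.Im R)) := congr1 (fun M : 'rV_n.+1 => M 0 j) zA.
  rewrite !mxE ReIm_sum => E.
  transitivity (\sum_i complex.Im (z 0 i * map_mx toC A i j)).
    apply: eq_bigr => i _; rewrite !mxE /toC; case: (z 0 i) => s t /=.
    by rewrite mulr0 add0r.
  by rewrite E; case: (z 0 j) => s t /=; rewrite addrC.
have xy0 : x != 0 \/ y != 0.
  apply/orP; rewrite -negb_and; apply: contra z0 => /andP[/eqP x0 /eqP y0].
  apply/eqP/rowP=> i; rewrite mxE.
  have := congr1 (fun M : 'rV_n.+1 => M 0 i) x0.
  have := congr1 (fun M : 'rV_n.+1 => M 0 i) y0.
  by rewrite !mxE; case: (z 0 i) => s t /= -> ->.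
(* Symmetry equates [dot (x *m A) y] with [dot (y *m A) x]; the terms in [a] cancel and leave
   [b * (dot x x + dot y y) = 0]. *)
have b0 : b = 0.
  have := dot_mulmx_sym x y sA; rewrite xA yA dotBl dotDl !dotZl (dotC y x).
  move=> E; have {E} : b * (dot x x + dot y y) = 0 by lra.
  move/eqP; rewrite mulf_eq0 => /orP[/eqP //|].
  case: xy0 => /dot_gt0 gt0; rewrite gt_eqF //.
    by rewrite ltr_pwDl ?dot_ge0.
  by rewrite ltr_pwDr ?dot_ge0.
exists a; case: xy0 => [x0|y0]; [exists x|exists y]; split=> //.
  by rewrite xA b0 scale0r subr0.
by rewrite yA b0 scale0r add0r.
Qed.

(* A Householder reflection exchanges the first basis vector with v. *)
Lemma orthomx_row0 n (v : 'rV[R]_n.+1) : dot v v = 1 ->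
  exists Q : 'M[R]_n.+1, Q *m Q^T = 1%:M /\ row 0 Q = v.
Proof.
move=> v1; pose e : 'rV[R]_n.+1 := delta_mx 0 0.
have [->|ve] := eqVneq v e.
  by exists 1%:M; rewrite trmx1 mulmx1 row1.
pose w := v - e; have w0 : dot w w != 0 by rewrite dot_eq0 subr_eq0.
pose c := 2 / dot w w; pose P := w^T *m w.
have PP : P *m P = dot w w *: P.
  by rewrite /P mulmxA -(mulmxA w^T) mul_row_trmx mul_mx_scalar -scalemxAl.
have sP : P^T = P by rewrite /P trmx_mul trmxK.
exists (1%:M - c *: P); split.
  have -> : (1%:M - c *: P)^T = 1%:M - c *: P.
    by apply/matrixP=> i j; rewrite -[in RHS]sP !mxE eq_sym.
  rewrite mulmxBl mul1mx mulmxBr mulmx1.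
  rewrite -scalemxAl -scalemxAr PP !scalerA.
  rewrite (_ : c * c * dot w w = c + c); last by rewrite /c; field.
  by rewrite scalerDl opprB addrK subrK.
have dve : dot v e = v 0 0.
  rewrite dotE (bigD1 0) //= big1 ?mxE ?eqxx ?mulr1 ?addr0 // => i i0.
  by rewrite mxE (negPf i0) andbF mulr0.
have dee : dot e e = 1.
  rewrite dotE (bigD1 0) //= big1 ?mxE ?eqxx ?mulr1 ?addr0 // => i i0.
  by rewrite !mxE (negPf i0) andbF mulr0.
(* Hence [c * w 0 0 = -1], so row 0 of the reflection is [e + w = v]. *)
have dww : dot w w = 2 - 2 * v 0 0.
  rewrite /w dotBl !(dotC _ (v - e)) !dotBl (dotC e v) v1 dve dee; ring.
apply/rowP=> j; rewrite !mxE big_ord1 !mxE eqxx /= /c.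
move: w0; rewrite dww (eq_sym 0 j) !(ord1 ord0) => w0.
by case: (j == 0); rewrite ?mulr1n ?mulr0n; field.
Qed.

(** By induction on the size: in an orthonormal basis starting with a unit eigenvector, symmetry
    makes the matrix block diagonal, and the lower block is handled by induction. Vectors act as
    rows, so the rows of [Q] are the eigenvectors. *)
Lemma symmx_orthodiag n (A : 'M[R]_n) : A^T = A ->
  exists (Q : 'M[R]_n) (d : 'rV[R]_n),
    Q *m Q^T = 1%:M /\ A = Q^T *m diag_mx d *m Q.
Proof.
elim: n A => [|n IHn] A sA.
  by exists 1%:M, 0; split; apply/matrixP => -[].
have [a [u [u0 uA]]] := symmx_eigenvector sA.
pose v := (Num.sqrt (dot u u))^-1 *: u.
have v1 : dot v v = 1.
  have uu := dot_gt0 u0; rewrite /v dotZl dotZr mulrA -invfM -expr2.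
  by rewrite sqr_sqrtr ?ltW // mulVf ?gt_eqF.
have vA : v *m A = a *: v by rewrite -scalemxAl uA !scalerA mulrC.
have [Q [QQ Qv]] := orthomx_row0 v1.
have QQ' := mulmx1C QQ.
have [M defM] : {M : 'M[R]_(1 + n) | M = Q *m A *m Q^T}.
  by exists (Q *m A *m Q^T).
have sM : M^T = M by rewrite defM !trmx_mul trmxK sA mulmxA.
have M0 j : M 0 j = a * (j == 0)%:R.
  have : row 0 M = a *: delta_mx 0 0.
    by rewrite defM !row_mul Qv vA -scalemxAl -Qv -row_mul QQ row1.
  by move/(congr1 (fun N : 'rV_n.+1 => N 0 j)); rewrite !mxE eqxx.
have drM : drsubmx M = (drsubmx M)^T by rewrite trmx_drsub sM.
have [Q' [d' [Q'Q' M']]] := IHn _ (esym drM).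
have eM : M = block_mx a%:M 0 0 (drsubmx M).
  rewrite -[LHS]submxK; congr block_mx; apply/matrixP=> i j; rewrite !ord1 !mxE.
  - by have := M0 0; rewrite eqxx mulr1 => <-; congr (M _ _); apply/val_inj.
  - by rewrite (_ : lshift n 0 = 0) ?M0 ?mulr0 //; apply/val_inj.
  - rewrite -[M]sM mxE (_ : lshift n 0 = 0) ?M0 ?mulr0 //; exact/val_inj.
pose P : 'M[R]_(1 + n) := block_mx 1%:M 0 0 Q'.
have PP : P *m P^T = 1%:M.
  rewrite /P tr_block_mx mulmx_block !trmx0 trmx1 !(mul0mx, mulmx0, mulmx1).
  by rewrite Q'Q' !(addr0, add0r) -scalar_mx_block.
have eP : M = P^T *m diag_mx (row_mx (a%:M : 'rV_1) d') *m P.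
  rewrite eM M' diag_mx_row /P tr_block_mx !mulmx_block !trmx0 trmx1.
  rewrite !(mul0mx, mulmx0, mulmx1, mul1mx, addr0, add0r).
  by congr block_mx; apply/matrixP=> i j; rewrite !ord1 !mxE.
exists (P *m Q), (row_mx a%:M d'); split.
  by rewrite trmx_mul mulmxA -(mulmxA P) QQ mulmx1.
have -> : A = Q^T *m M *m Q.
  by rewrite defM !mulmxA QQ' mul1mx -mulmxA QQ' mulmx1.
by rewrite eP trmx_mul !mulmxA.
Qed.

End RealSpectral.

(** * Counting eigenvalues by means of subspaces *)

Section Inertia.
Variables (R : rcfType) (n : nat) (A Q : 'M[R]_n) (d : 'rV[R]_n).
Hypotheses (QQ : Q *m Q^T = 1%:M) (AE : A = Q^T *m diag_mx d *m Q).

Lemma orthodiag_char_poly : char_poly A = \prod_i ('X - (d 0 i)%:P).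
Proof.
have -> : \prod_i ('X - (d 0 i)%:P) = char_poly (diag_mx d).
  rewrite char_poly_trig ?diag_mx_is_trig //.
  by apply: eq_bigr => i _; rewrite mxE eqxx.
pose Qp := map_mx (@polyC R) Q.
have QQp : \det (Qp^T) * \det Qp = 1.
  by rewrite mulrC -det_mulmx map_trmx -map_mxM QQ map_scalar_mx det1.
rewrite /char_poly.
have -> : char_poly_mx A = Qp^T *m char_poly_mx (diag_mx d) *m Qp.
  rewrite /char_poly_mx mulmxBr mulmxBl map_trmx -!map_mxM -AE.
  rewrite scalar_mxC -mulmxA -map_mxM (mulmx1C QQ).
  by rewrite map_scalar_mx mulmx1.
by rewrite !det_mulmx mulrAC QQp mul1r.
Qed.

Lemma orthodiag_trace : \tr A = \sum_i d 0 i.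
Proof. by rewrite AE mxtrace_mulC mulmxA QQ mul1mx mxtrace_diag. Qed.

Lemma orthodiag_mul (x : 'rV[R]_n) i :
  (x *m A *m Q^T) 0 i = d 0 i * (x *m Q^T) 0 i.
Proof.
by rewrite AE -!mulmxA QQ mulmx1 mulmxA mul_mx_diag mxE mulrC.
Qed.

Lemma orthodiag_dot (x y : 'rV[R]_n) : dot x y = dot (x *m Q^T) (y *m Q^T).
Proof.
by rewrite /dot trmx_mul trmxK mulmxA -(mulmxA x) (mulmx1C QQ) mulmx1.
Qed.

Lemma orthodiag_dot_sqr (x : 'rV[R]_n) : dot x x = \sum_i (x *m Q^T) 0 i ^+ 2.
Proof. by rewrite orthodiag_dot dotE; apply: eq_bigr => i _; rewrite expr2. Qed.

Lemma orthodiag_form (x : 'rV[R]_n) :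
  dot (x *m A) x = \sum_i d 0 i * (x *m Q^T) 0 i ^+ 2.
Proof.
rewrite orthodiag_dot dotE; apply: eq_bigr => i _.
by rewrite orthodiag_mul expr2 mulrA.
Qed.

Lemma orthodiag_coord0 (x : 'rV[R]_n) :
  (forall i, (x *m Q^T) 0 i = 0) -> x = 0.
Proof.
move=> x0; have : x *m Q^T *m Q = 0.
  by rewrite (_ : x *m Q^T = 0) ?mul0mx //; apply/rowP=> i; rewrite x0 mxE.
by rewrite -mulmxA (mulmx1C QQ) mulmx1.
Qed.

Lemma orthodiag_row i : row i Q *m A = d 0 i *: row i Q.
Proof.
rewrite AE -row_mul !mulmxA QQ mul1mx row_mul row_diag_mx -scalemxAl.
by rewrite -rowE.
Qed.

Lemma orthodiag_eigenvalue i : eigenvalue A (d 0 i).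
Proof.
rewrite eigenvalue_root_char orthodiag_char_poly.
by rewrite /root horner_prod (bigD1 i) //= hornerXsubC subrr mul0r.
Qed.

(** Dimension count: the columns of [N] and the coordinates in [S] impose fewer than [k] linear
    conditions on a space of dimension [k]. *)
Lemma exists_row_orthogonal k p (U : 'M[R]_(k, n)) (N : 'M[R]_(n, p))
    (S : {set 'I_n}) : row_free U -> (p + #|S| < k)%N ->
  exists x : 'rV[R]_n, [/\ (x <= U)%MS, x != 0, x *m N = 0 &
    {in S, forall i, (x *m Q^T) 0 i = 0}].
Proof.
move=> fU lt_k; pose M := row_mx N (colsub (@enum_val _ (mem S)) Q^T).
have : kermx (U *m M) != 0.
  rewrite kermx_eq0 -row_leq_rank -ltnNge.
  exact: leq_ltn_trans (rank_leq_col _) lt_k.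
rewrite -nz_row_eq0; set y := nz_row _ => y0.
have yM : y *m U *m M = 0.
  by rewrite -mulmxA; apply/sub_kermxP; exact: nz_row_sub.
exists (y *m U); split; first exact: submxMl.
- by rewrite -[0](mul0mx 1 U) (inj_eq (row_free_inj fU)).
- by move: yM; rewrite mul_mx_row -row_mx0 => /eq_row_mx[].
- move=> i iS; move: yM; rewrite mul_mx_row -row_mx0 => /eq_row_mx[_].
  move/(congr1 (fun v : 'rV_#|S| => v 0 (enum_rank_in iS i))).
  by rewrite mulmx_colsub !mxE enum_rankK_in // => ->.
Qed.

(** A Courant-Fischer bound. Otherwise some nonzero [x] in the constrained space would have
    coordinates only at eigenvalues below [c], making its form strictly smaller than
    [c * dot x x]. *)
Lemma leq_card_eig_ge k p (U : 'M[R]_(k, n)) (N : 'M[R]_(n, p)) c :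
    row_free U ->
    (forall x : 'rV[R]_n, (x <= U)%MS -> x *m N = 0 ->
       c * dot x x <= dot (x *m A) x) ->
  (k <= p + #|[set i | (c <= d 0 i)%R]|)%N.
Proof.
move=> fU hU; rewrite leqNgt; apply/negP => /(exists_row_orthogonal N fU).
case=> x [xU x0 xN xS]; have := hU x xU xN.
rewrite orthodiag_form orthodiag_dot_sqr mulr_sumr leNgt => /negP; apply.
have [i xi] : exists i, (x *m Q^T) 0 i != 0.
  apply/existsP; apply: contraR x0; rewrite negb_exists => /forallP h.
  by apply/eqP/orthodiag_coord0 => i; apply/eqP; rewrite -[_ == _]negbK.
have lt_dc j : (x *m Q^T) 0 j != 0 -> d 0 j < c.
  by apply: contraR; rewrite -leNgt => cd; rewrite xS ?inE.
rewrite (bigD1 i) //= [ltRHS](bigD1 i) //=; apply: ltr_leD.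
  by rewrite ltr_pM2r ?lt_dc // exprn_even_gt0.
apply: ler_sum => j _; have [->|/lt_dc/ltW ?] := eqVneq ((x *m Q^T) 0 j) 0.
  by rewrite expr0n !mulr0.
by rewrite ler_wpM2r ?sqr_ge0.
Qed.

Lemma leq_card_eig_eq k (U : 'M[R]_(k, n)) c :
  row_free U -> U *m A = c *: U -> (k <= #|[set i | (d 0 i == c)%R]|)%N.
Proof.
move=> fU UA; rewrite leqNgt -[X in (X < _)%N]add0n; apply/negP.
move=> /(exists_row_orthogonal 0 fU)[x [/submxP[y ->] x0 _ xS]].
case/eqP: x0; apply: orthodiag_coord0 => i.
have := orthodiag_mul (y *m U) i.
rewrite -(mulmxA y U) UA -scalemxAr -scalemxAl.
rewrite mxE => /eqP; rewrite -subr_eq0 -mulrBl mulf_eq0 => /orP[|/eqP //].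
by rewrite subr_eq0 eq_sym => di; rewrite xS ?inE.
Qed.

End Inertia.

(** The lower bound applied to [- A], which the same [Q] diagonalises; it stands outside the section
    so that the matrix can be instantiated. *)
Lemma leq_card_eig_le (R : rcfType) n (A Q : 'M[R]_n) (d : 'rV[R]_n) k p
    (U : 'M[R]_(k, n)) (N : 'M[R]_(n, p)) c :
    Q *m Q^T = 1%:M -> A = Q^T *m diag_mx d *m Q -> row_free U ->
    (forall x : 'rV[R]_n, (x <= U)%MS -> x *m N = 0 ->
       dot (x *m A) x <= c * dot x x) ->
  (k <= p + #|[set i | (d 0 i <= c)%R]|)%N.
Proof.
move=> QQ AE fU hU.
have NAE : - A = Q^T *m diag_mx (- d) *m Q.
  by rewrite raddfN /= mulmxN mulNmx -AE.
have -> : [set i | (d 0 i <= c)%R] = [set i | (- c <= (- d) 0 i)%R].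
  by apply/setP=> i; rewrite !inE mxE lerN2.
apply: (leq_card_eig_ge (N := N) QQ NAE fU) => x xU xN.
have -> : dot (x *m - A) x = - dot (x *m A) x by rewrite mulmxN /dot mulNmx mxE.
by rewrite mulNr lerN2 hU.
Qed.

Lemma mup_prod_XsubC (R : fieldType) (s : seq R) y :
  mup y (\prod_(x <- s) ('X - x%:P)) = count_mem y s.
Proof.
elim: s => [|x s IHs]; first by rewrite big_nil mupNroot // root1.
rewrite big_cons mupM ?polyXsubC_eq0 ?monic_neq0 ?monic_prod_XsubC //= IHs.
by rewrite -[_ - _]expr1 mup_XsubCX eq_sym; case: eqP.
Qed.

(** * The spectrum of a graph read off a diagonalisation *)

Section GraphSpectrum.
Variables (R : rcfType) (G : sgraph).

Lemma adjmx_sym : (adjmx R G)^T = adjmx R G.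
Proof. by apply/matrixP=> i j; rewrite !mxE adj_sym. Qed.

Lemma adjmx_trace : \tr (adjmx R G) = 0.
Proof. by apply: big1 => i _; rewrite mxE adj_irrefl. Qed.

Lemma adjmx_orthodiag : exists (Q : 'M[R]_#|vertex G|) (d : 'rV[R]_#|vertex G|),
  Q *m Q^T = 1%:M /\ adjmx R G = Q^T *m diag_mx d *m Q.
Proof. exact/symmx_orthodiag/adjmx_sym. Qed.

Variables (Q : 'M[R]_#|vertex G|) (d : 'rV[R]_#|vertex G|).
Hypotheses (QQ : Q *m Q^T = 1%:M) (AE : adjmx R G = Q^T *m diag_mx d *m Q).

Lemma char_poly_adjmx :
  char_poly (adjmx R G) = \prod_(x <- codom (d 0)) ('X - x%:P).
Proof.
by rewrite (orthodiag_char_poly QQ AE) big_map big_enum.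
Qed.

(** Root multiplicities of a split polynomial are occurrence counts in its list of roots. This turns
    counts of eigenvalues into cardinals of index sets. *)
Lemma perm_spectrum : perm_eq (spectrum R G) (codom (d 0)).
Proof.
rewrite /spectrum perm_sort; set s := codom _.
have eig_s x : eig_mult G x = count_mem x s.
  by rewrite /eig_mult char_poly_adjmx mup_prod_XsubC.
rewrite (eq_map (fun x => congr1 (nseq^~ x) (eig_s x))).
apply: perm_trans (perm_count_undup s); apply: perm_flatten; apply: perm_map.
apply: uniq_perm; rewrite ?undup_uniq ?uniq_roots // => x.
have := roots_on_rootsR (monic_neq0 (char_poly_monic (adjmx R G))) x.
by rewrite in_itv /= mem_undup char_poly_adjmx root_prod_XsubC => ->.
Qed.

Lemma count_spectrum P : count P (spectrum R G) = #|[set i | P (d 0 i)]|.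
Proof.
rewrite (permP perm_spectrum) -sum1_count big_map big_enum_cond /=.
by rewrite sum1dep_card.
Qed.

Lemma eig_mult_spectrum x : eig_mult G x = count_mem x (spectrum R G).
Proof.
by rewrite /eig_mult char_poly_adjmx mup_prod_XsubC (permP perm_spectrum).
Qed.

Lemma sum_spectrum : \sum_(x <- spectrum R G) x = 0.
Proof.
rewrite (perm_big _ perm_spectrum) big_map big_enum /=.
by rewrite -(orthodiag_trace QQ AE) adjmx_trace.
Qed.

End GraphSpectrum.

(** * Entrywise absolute values, and row selections of orthogonal matrices *)

Section FormNorm.
Variables (R : rcfType) (n : nat).
Implicit Type x : 'rV[R]_n.

Local Notation absmx x := (map_mx Num.norm x).

Lemma dot_absmx x : dot (absmx x) (absmx x) = dot x x.
Proof.
rewrite !dotE; apply: eq_bigr => i _.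
by rewrite !mxE -normrM ger0_norm -?expr2 ?sqr_ge0.
Qed.

Lemma norm_form_le (A : 'M[R]_n) x : (forall i j, 0 <= A i j) ->
  `|dot (x *m A) x| <= dot (absmx x *m A) (absmx x).
Proof.
move=> A0; rewrite !dotE; apply: (le_trans (ler_norm_sum _ _ _)).
apply: ler_sum => j _; rewrite normrM !mxE ler_wpM2r //.
apply: (le_trans (ler_norm_sum _ _ _)); apply: ler_sum => i _.
by rewrite normrM !mxE (ger0_norm (A0 _ _)).
Qed.

Lemma dot_absmx1_gt0 x : x != 0 -> 0 < dot (absmx x) (const_mx 1).
Proof.
move=> x0; rewrite lt_def dotE; apply/andP; split; last first.
  by apply: sumr_ge0 => i _; rewrite !mxE mulr1.
apply: contra x0; rewrite psumr_eq0 => [/allP h|i _]; last first.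
  by rewrite !mxE mulr1.
apply/eqP/rowP=> i; apply/eqP; rewrite mxE -normr_eq0.
by have := h i (mem_index_enum i); rewrite !mxE mulr1.
Qed.

Lemma rowsub_orthomx_free k (Q : 'M[R]_n) (f : 'I_k -> 'I_n) :
  Q *m Q^T = 1%:M -> injective f -> row_free (rowsub f Q).
Proof.
move=> QQ finj; apply/row_freeP; exists (rowsub f Q)^T.
apply/matrixP=> i j.
have := congr1 (fun M : 'M_n => M (f i) (f j)) QQ.
rewrite !mxE (inj_eq finj) => <-; apply: eq_bigr => l _; rewrite !mxE //.
Qed.

Lemma rowsub_orthomx_coord (S : {set 'I_n}) (Q : 'M[R]_n) x i :
  Q *m Q^T = 1%:M -> (x <= rowsub (@enum_val _ (mem S)) Q)%MS ->
  i \notin S -> (x *m Q^T) 0 i = 0.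
Proof.
move=> QQ /submxP[y ->] iS; rewrite -mulmxA mul_rowsub_mx QQ mxE big1 // => k _.
rewrite !mxE; case: eqP => [ki|_]; last by rewrite mulr0.
by rewrite -ki enum_valP in iS.
Qed.

End FormNorm.

(** * Largest eigenvalue and spectral radius; adjacency of the complement *)

Section AnyGraph.
Variables (R : rcfType) (G : sgraph).
Local Notation H := (complement G).
Local Notation ones := (const_mx 1 : 'rV[R]_#|vertex G|).

Lemma spectrum_sorted : sorted >=%R (spectrum R G).
Proof. by apply: sort_sorted => x y; rewrite /= orbC le_total. Qed.

Lemma spectrum_le_largest x : x \in spectrum R G -> x <= largest_eig R G.
Proof.
rewrite /largest_eig; have := spectrum_sorted; case: (spectrum R G) => //= y s.
move/(order_path_min (rev_trans le_trans))/allP => ys.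
by rewrite inE => /predU1P[->//|/ys].
Qed.

Lemma mem_spectrum_eigenvalue x :
  x \in spectrum R G -> eigenvalue (adjmx R G) x.
Proof.
have [Q [d [QQ AE]]] := adjmx_orthodiag R G.
rewrite (perm_mem (perm_spectrum QQ AE)) => /codomP[i ->].
exact: orthodiag_eigenvalue AE _.
Qed.

Lemma size_spectrum : size (spectrum R G) = #|vertex G|.
Proof.
have [Q [d [QQ AE]]] := adjmx_orthodiag R G.
by rewrite (perm_size (perm_spectrum QQ AE)) size_codom card_ord.
Qed.

(* Replacing an eigenvector by its entrywise absolute value can only increase *)
(* the Rayleigh quotient of a nonnegative matrix.                             *)
Lemma spectrum_norm_le_largest x :
  x \in spectrum R G -> `|x| <= largest_eig R G.
Proof.
have [Q [d [QQ AE]]] := adjmx_orthodiag R G.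
have pS := perm_spectrum QQ AE; rewrite (perm_mem pS) => /codomP[i ->].
have q1 : dot (row i Q) (row i Q) = 1.
  have := congr1 (fun M : 'M_#|vertex G| => M i i) QQ.
  by rewrite dotE !mxE eqxx mulr1n => <-; apply: eq_bigr => l _; rewrite !mxE.
have := @norm_form_le R _ (adjmx R G) (row i Q) _.
rewrite (orthodiag_row QQ AE) dotZl q1 mulr1 => /(_ _)/le_trans; apply.
  by move=> k l; rewrite mxE ler0n.
rewrite (orthodiag_form QQ AE); set y := map_mx _ _.
apply: (@le_trans _ _ (\sum_j largest_eig R G * (y *m Q^T) 0 j ^+ 2)).
  apply: ler_sum => j _; rewrite ler_wpM2r ?sqr_ge0 // spectrum_le_largest //.
  by rewrite (perm_mem pS) codom_f.
by rewrite -mulr_sumr -(orthodiag_dot_sqr QQ) dot_absmx q1 mulr1.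
Qed.

Lemma largest_eig_spectral_radius : largest_eig R G = spectral_radius R G.
Proof.
have := spectrum_norm_le_largest; rewrite /spectral_radius /largest_eig.
case: (spectrum R G) => [|y s] /= sub; first by rewrite big_nil.
have y0 : 0 <= y by apply: le_trans (sub y (mem_head _ _)).
apply/le_anti/andP; split.
  by rewrite -{1}(ger0_norm y0); apply: le_bigmax_seq (mem_head _ _) isT.
by rewrite big_seq; apply: bigmax_le => // z /sub.
Qed.

Lemma mul_adjmx_complement (x : 'rV[R]_#|vertex G|) :
  x *m (adjmx R H : 'M_#|vertex G|) = dot x ones *: ones - x - x *m adjmx R G.
Proof.
have -> : adjmx R H = ones^T *m ones - 1%:M - adjmx R G :> 'M_#|vertex G|.
  apply/matrixP=> i j; rewrite !mxE big_ord1 !mxE mulr1 /= /compl_adj.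
  rewrite (inj_eq enum_val_inj); case: eqP => [->|_].
    by rewrite adj_irrefl subrr subr0.
  by rewrite mulr0n subr0; case: adj; rewrite /= ?mulr1n ?mulr0n ?subrr ?subr0.
by rewrite !mulmxBr mulmxA mul_row_trmx mul_scalar_mx mulmx1.
Qed.

End AnyGraph.

(** The entries that are at least 1 and those that are at most -1 exhaust the list, so exactly
    [d.+1] entries are positive and all of these are at least 1. *)
Lemma sorted_filter_gt0 (R : realFieldType) (s : seq R) d :
    sorted >=%R s -> (d.+1 <= count (fun x => 1 <= x)%R s)%N ->
    (size s <= d.+1 + count (fun x => x <= -1)%R s)%N ->
    (d <= count_mem 1%R s)%N ->
  [seq x <- s | 0 < x] = head 0 s :: nseq d 1.
Proof.
move=> s_sorted c1 cN cE.
have ct : count (fun x => 1 <= x) [seq x <- s | 0 < x] =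
    count (fun x => 1 <= x) s.
  rewrite count_filter; apply: eq_count => x /=.
  by apply: andb_idr => x1; apply: lt_le_trans x1.
have ce : count_mem 1 [seq x <- s | 0 < x] = count_mem 1 s.
  rewrite count_filter; apply: eq_count => x /=.
  by case: eqP => // ->; rewrite ltr01.
have cp : (count (fun x => (0 < x)%R) s <= d.+1)%N.
  rewrite -(leq_add2r (count (fun x => x <= -1)%R s)); apply: leq_trans cN.
  rewrite -(count_predC (fun x : R => 0 < x)) leq_add2l.
  apply: sub_count => x /=.
  by rewrite -leNgt => /le_trans; apply; rewrite lerN10.
have ge1 : all (fun x => 1 <= x) [seq x <- s | 0 < x].
  rewrite all_count ct eqn_leq; apply/andP; split.
    by rewrite -ct count_size.
  by rewrite size_filter; apply: leq_trans c1.
have st : size [seq x <- s | 0 < x] = d.+1.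
  apply/eqP; rewrite eqn_leq size_filter cp /= -size_filter.
  by rewrite (leq_trans c1) // -ct count_size.
case: s => [|h s] in s_sorted c1 ct ce cE cN cp ge1 st *; first by [].
have hs : all (fun x => x <= h) s :=
  order_path_min (rev_trans le_trans) s_sorted.
move: ge1 st ce; rewrite /=; case: ltP => [h0|h0]; last first.
  rewrite (@eq_in_filter _ _ pred0) ?filter_pred0 // => x /(allP hs) /= xh.
  by apply/negbTE; rewrite -leNgt (le_trans xh).
move=> /= /andP[h1 ge1] [st] ce; congr cons; rewrite -{}st in cE *.
(* If the head is 1, the positive entries are squeezed between 1 and the head. Otherwise the [d]
   ones must fill the positive tail, which has length [d]. *)
apply/all_pred1P; have [hE|hN] := eqVneq h 1.
  apply/allP=> x xs /=; rewrite eq_le (allP ge1 _ xs) -hE andbT.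
  by apply: (allP hs); move: xs; rewrite mem_filter => /andP[].
rewrite all_count eqn_leq count_size /=.
by move: ce cE; rewrite /= (negPf hN) !add0n => ->.
Qed.

(** * Positive eigenvalues and energy of the complement *)

Section ComplementSpectrum.
Variables (R : rcfType) (G : sgraph).
Local Notation H := (complement G).
Local Notation ones := (const_mx 1 : 'rV[R]_#|vertex G|).
Hypothesis rho : property_rho R G.
Hypothesis eigN2_orthogonal_ones : forall x : 'rV[R]_#|vertex G|,
  x *m adjmx R G = -2 *: x -> dot x ones = 0.
Local Notation d := (eig_mult G (-2 : R)).
Hypothesis d_gt0 : (0 < d)%N.

Lemma filter_gt0_spectrum_complement :
  [seq x <- spectrum R H | 0 < x] = largest_eig R H :: nseq d 1.
Proof.
have [Q [D [QQ AE]]] := adjmx_orthodiag R G.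
have [Q' [D' [QQ' AE']]] := adjmx_orthodiag R H.
pose S := [set i | D 0 i == -2]; pose T := [set i | (0 <= D 0 i)%R].
have dS : d = #|S| by rewrite (eig_mult_spectrum QQ AE) (count_spectrum QQ AE).
(* Property rho makes [S] the complement of [T]: a negative eigenvalue is -2. *)
have cardT : (#|vertex G| = #|S| + #|T|)%N.
  rewrite -[LHS]card_ord -(cardsC T) addnC; congr addn; congr #|pred_of_set _|.
  apply/setP=> i; rewrite !inE -ltNge.
  apply/idP/eqP => [/rho -> //|->]; last by rewrite oppr_lt0.
  exact: orthodiag_eigenvalue QQ AE i.
pose US := rowsub (@enum_val _ (mem S)) Q.
pose UT := rowsub (@enum_val _ (mem T)) Q.
have fS : row_free US by apply: rowsub_orthomx_free QQ (@enum_val_inj _ _).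
have fT : row_free UT by apply: rowsub_orthomx_free QQ (@enum_val_inj _ _).
have USG (x : 'rV_#|vertex G|) : (x <= US)%MS -> x *m adjmx R G = -2 *: x.
  have : US *m adjmx R G = -2 *: US.
    apply/row_matrixP=> i; rewrite row_mul linearZ /= row_rowsub.
    rewrite (orthodiag_row QQ AE).
    by have := enum_valP i; rewrite inE => /eqP ->.
  by move=> E /submxP[y ->]; rewrite -mulmxA E scalemxAr.
have USH (x : 'rV_#|vertex G|) : (x <= US)%MS ->
    x *m (adjmx R H : 'M_#|vertex G|) = x.
  move=> /USG xG.
  rewrite mul_adjmx_complement xG eigN2_orthogonal_ones // scale0r.
  rewrite sub0r -scaleN1r -scalerBl.
  rewrite (_ : -1 - -2 = 1) ?scale1r //; ring.
have [x0 [x0S x0N0]] : exists x : 'rV[R]_#|vertex G|, (x <= US)%MS /\ x != 0.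
  exists (nz_row US); rewrite nz_row_sub nz_row_eq0 -mxrank_eq0.
  by rewrite (eqP fS) -dS -lt0n.
pose y := map_mx Num.norm x0.
(* [x0] is fixed by the complement, so its form equals its squared norm; passing to absolute values
   keeps the norm and does not decrease the form. *)
have y_form : dot y y <= dot (y *m (adjmx R H : 'M_#|vertex G|)) y.
  rewrite dot_absmx -[X in dot X _ <= _](USH _ x0S).
  apply: le_trans (ler_norm _) _; apply: norm_form_le => i j.
  by rewrite mxE ler0n.
have y_ones : dot y ones != 0 by rewrite gt_eqF ?dot_absmx1_gt0.
apply: sorted_filter_gt0; first exact: spectrum_sorted.
- rewrite (count_spectrum QQ' AE') dS -add1n -[X in (_ <= X)%N]add0n.
  apply: (leq_card_eig_ge (U := col_mx y US) (N := 0) QQ' AE').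
    (* Pairing a linear relation with [ones] kills the part in [US], so the coefficient of [y]
       vanishes. *)
    apply: inj_row_free => v; rewrite -[v]hsubmxK mul_row_col => vU.
    set a := lsubmx v in vU *; set w := rsubmx v in vU *.
    have aE : a *m y = (a 0 0) *: y by rewrite {1}[a]mx11_scalar mul_scalar_mx.
    have a0 : a 0 0 = 0.
      have := congr1 (fun z => dot z ones) vU.
      rewrite aE dotDl dotZl addrC.
      rewrite (eigN2_orthogonal_ones (USG _ (submxMl _ _))) add0r.
      rewrite (_ : dot 0 ones = 0) => [/eqP|]; last by rewrite /dot mul0mx mxE.
      rewrite mulf_eq0 (negPf y_ones) orbF.
      by move/eqP.
    move: vU; rewrite aE a0 scale0r add0r => /eqP.
    rewrite -[0](mul0mx 1 US) (inj_eq (row_free_inj fS)) => /eqP ->.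
    by rewrite [a]mx11_scalar a0 raddf0 row_mx0.
  (* For [x = a *: y + u] with [u] fixed by the complement, form and squared norm differ only in
     their [a ^+ 2] terms, which [y_form] compares. *)
  move=> x /submxP[v ->] _; rewrite -[v]hsubmxK mul_row_col mul1r.
  rewrite [lsubmx v]mx11_scalar mul_scalar_mx; set a := lsubmx v 0 0.
  have := USH _ (submxMl (rsubmx v) US); set u := rsubmx v *m US => uH.
  rewrite mulmxDl uH -scalemxAl !dotDl !dotDr !dotZl !dotZr.
  have -> : dot (y *m adjmx R H) u = dot y u.
    by rewrite (dot_mulmx_sym _ _ (adjmx_sym R H)) uH dotC.
  by have := ler_wpM2l (sqr_ge0 a) y_form; lra.
- rewrite size_spectrum [X in (X <= _)%N]cardT (count_spectrum QQ' AE') dS.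
  (* The extra 1 pays for the single constraint of orthogonality to [ones]. *)
  rewrite addSn -addnS leq_add2l -add1n.
  apply: (leq_card_eig_le (U := UT) (N := ones^T) QQ' AE' fT) => x xT.
  rewrite mul_row_trmx => /(congr1 (fun M : 'M_1 => M 0 0)).
  rewrite !mxE eqxx mulr1n => x1.
  rewrite mul_adjmx_complement x1 scale0r sub0r dotBl.
  rewrite -scaleN1r dotZl gerDl oppr_le0.
  rewrite (orthodiag_form QQ AE) sumr_ge0 // => i _.
  have [iT|iT] := boolP (i \in T).
    by rewrite mulr_ge0 ?sqr_ge0 //; move: iT; rewrite inE.
  by rewrite (rowsub_orthomx_coord QQ xT iT) expr0n mulr0.
- rewrite (count_spectrum QQ' AE') dS.
  apply: (leq_card_eig_eq (U := US) QQ' AE' fS); rewrite scale1r.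
  by apply/row_matrixP=> i; rewrite row_mul; apply: USH; apply: row_sub.
Qed.

(** The absolute value of an eigenvalue [x] is [x + 4] if [x] is -2 and [x] otherwise, and the
    eigenvalues sum to 0. *)
Lemma energy_property_rho : energy R G = 4 * d%:R.
Proof.
have [Q [D [QQ AE]]] := adjmx_orthodiag R G.
rewrite /energy (eig_mult_spectrum QQ AE).
transitivity (\sum_(x <- spectrum R G) (x + (if x == -2 then 4 else 0))).
  rewrite !big_seq; apply: eq_bigr => x /mem_spectrum_eigenvalue /rho xN.
  case: eqP => [->|/eqP x2]; first by rewrite normrN ger0_norm //; ring.
  rewrite addr0 ger0_norm // leNgt; apply: contra x2 => /xN ->; exact: eqxx.
rewrite big_split /= (sum_spectrum QQ AE) add0r -big_mkcond /=.
by rewrite big_const_seq iter_addr_0 mulr_natr.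
Qed.

(** By the zero trace, the energy is twice the sum of the positive eigenvalues; the ones contribute
    [2 * d], half the energy of [G]. *)
Lemma energy_complement :
  energy R H = 2 * largest_eig R H + energy R G / 2.
Proof.
have [Q [D [QQ AE]]] := adjmx_orthodiag R H.
rewrite energy_property_rho /energy.
transitivity (\sum_(x <- spectrum R H) ((if 0 < x then 2 * x else 0) - x)).
  apply: eq_bigr => x _; case: ltrP => x0; first by rewrite gtr0_norm //; ring.
  by rewrite ler0_norm // sub0r.
rewrite big_split /= sumrN (sum_spectrum QQ AE) subr0 -big_mkcond /=.
rewrite -big_filter filter_gt0_spectrum_complement big_cons.
by rewrite big_nseq iter_addr_0 -mulr_natr; field.
Qed.

End ComplementSpectrum.

(** * The incidence matrix and the eigenvalue -2 of a line graph *)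

Section LineGraphSpectrum.
Variables (R : rcfType) (G : sgraph).
Local Notation L := (line_graph G).

Lemma card_edge (e : {set vertex G}) : e \in edges G -> #|e| = 2.
Proof.
case/imsetP=> -[x y]; rewrite inE /= => xy ->; rewrite cards2.
by case: eqP xy => // ->; rewrite adj_irrefl.
Qed.

Lemma card_line_graph : #|vertex L| = graph_size G.
Proof. by rewrite /= card_sig. Qed.

Definition incmx : 'M[R]_(#|vertex L|, #|vertex G|) :=
  \matrix_(i, j) (enum_val j \in val (enum_val i : edge_type G))%:R.

(** Each entry counts the common vertices of two edges: 2 on the diagonal, at most 1 elsewhere since
    distinct edges cannot share both ends. *)
Lemma incmx_gram : incmx *m incmx^T = adjmx R L + 2%:M.
Proof.
apply/matrixP=> i j; rewrite !mxE.
set e : edge_type G := enum_val i; set f : edge_type G := enum_val j.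
transitivity (#|val e :&: val f|%:R : R).
  rewrite -sum1_card natr_sum [RHS]big_mkcond /=.
  rewrite [RHS](reindex _ (onW_bij _ (enum_val_bij _))) /=.
  apply: eq_bigr => k _; rewrite !mxE inE -/e -/f -natrM mulnb.
  by case: (_ && _).
have -> : (i == j) = (e == f) by rewrite (inj_eq enum_val_inj).
rewrite /= /line_adj; have [->|ef] := eqVneq e f.
  by rewrite setIid card_edge ?(valP f) //= add0r.
rewrite mulr0n addr0 /= -card_gt0; congr (_%:R)%R; apply/eqP.
have : (#|val e :&: val f| < 2)%N.
  rewrite ltnNge; apply: contra ef => le2; apply/eqP/val_inj.
  have eI : val e :&: val f = val e.
    by apply/eqP; rewrite eqEcard subsetIl card_edge ?(valP e).
  have fI : val e :&: val f = val f.
    by apply/eqP; rewrite eqEcard subsetIr card_edge ?(valP f).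
  by rewrite -[LHS]eI fI.
by case: #|_| => [|[]].
Qed.

Lemma incmx_row_sum :
  incmx *m (const_mx 1 : 'rV[R]_#|vertex G|)^T =
  2 *: (const_mx 1 : 'rV_#|vertex L|)^T.
Proof.
apply/matrixP=> i j; rewrite !mxE mulr1.
have <- : #|val (enum_val i : edge_type G)|%:R = 2 :> R.
  by rewrite card_edge //; apply: valP.
rewrite -sum1_card natr_sum.
rewrite [RHS]big_mkcond /= [RHS](reindex _ (onW_bij _ (enum_val_bij _))) /=.
by apply: eq_bigr => k _; rewrite !mxE mulr1; case: (_ \in _).
Qed.

(** The Gram identity makes the squared norm of [x *m incmx] zero, and by the row sums [incmx] sends
    the all-ones vector to twice the all-ones vector. *)
Lemma line_graph_eigN2_orthogonal (x : 'rV[R]_#|vertex L|) :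
  x *m adjmx R L = -2 *: x -> dot x (const_mx 1) = 0.
Proof.
move=> xL; have xN : x *m incmx = 0.
  apply/eqP; rewrite -dot_eq0 /dot trmx_mul mulmxA -(mulmxA x) incmx_gram.
  rewrite mulmxDr xL mul_mx_scalar -scalerDl addNr scale0r mul0mx mxE eqxx //.
have : x *m incmx *m (const_mx 1 : 'rV[R]_#|vertex G|)^T = 0.
  by rewrite xN mul0mx.
rewrite -mulmxA incmx_row_sum -scalemxAr mul_row_trmx.
move/(congr1 (fun M : 'M_1 => M 0 0)); rewrite !mxE eqxx mulr1n => /eqP.
by rewrite mulf_eq0 pnatr_eq0 => /eqP.
Qed.

(* If -2 is not an eigenvalue, the trace forces the line graph to be          *)
(* edgeless, so that the edges of G are disjoint pairs of vertices.           *)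
Lemma line_graph_eigN2_gt0 : property_rho R L -> (0 < graph_size G)%N ->
  (graph_order G <= graph_size G)%N -> (0 < eig_mult L (-2 : R))%N.
Proof.
move=> rho m_gt0 le_nm; rewrite lt0n; apply/eqP => m2.
have [Q [D [QQ AE]]] := adjmx_orthodiag R L.
have D_ge0 i : 0 <= D 0 i.
  rewrite leNgt; apply/negP => Di.
  have Di2 := rho _ (orthodiag_eigenvalue QQ AE i) Di.
  move: m2; rewrite (eig_mult_spectrum QQ AE) (count_spectrum QQ AE) => /eqP.
  by rewrite cards_eq0 => /eqP/setP/(_ i); rewrite !inE Di2 eqxx.
have D0 : D = 0.
  have := adjmx_trace R L; rewrite (orthodiag_trace QQ AE) => /eqP.
  rewrite psumr_eq0 => [/allP h|//]; apply/rowP=> i; rewrite mxE; apply/eqP.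
  exact: (h i (mem_index_enum i)).
have A0 : adjmx R L = 0 by rewrite AE D0 raddf0 mulmx0 mul0mx.
have triv : trivIset (edges G).
  apply/trivIsetP=> e f eG fG ef; rewrite -setI_eq0; apply: contraT => ef0.
  pose e' : edge_type G := exist _ e eG; pose f' : edge_type G := exist _ f fG.
  have := congr1 (fun M : 'M_#|vertex L| => M (enum_rank e') (enum_rank f')) A0.
  rewrite !mxE !enum_rankK /= /line_adj /= ef0 andbT.
  by rewrite -val_eqE /= ef => /eqP; rewrite oner_eq0.
(* Disjoint edges cover twice as many vertices as there are edges, which is impossible when the
   order is at most the positive size. *)
have : (#|cover (edges G)| <= #|vertex G|)%N := max_card _.
rewrite -(eqP triv) (eq_bigr (fun=> 2%N)); last by move=> e; apply: card_edge.
rewrite sum_nat_const; move: le_nm m_gt0; rewrite /graph_order /graph_size; lia.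
Qed.

End LineGraphSpectrum.

Theorem theorem5p2 (R : rcfType) (G : sgraph) (k : nat)
  (hk : (1 <= k)%N)
  (hne : (0 < graph_order (iter_line k G))%N)
  (hrho : property_rho R (iter_line k G))
  (hmult : (eig_mult (iter_line k G) (- 2 : R))%:Z =
           (graph_size (iter_line k.-1 G))%:Z
           - (graph_order (iter_line k.-1 G))%:Z) :
  let H := complement (iter_line k G) in
  let d := (graph_size (iter_line k.-1 G)
            - graph_order (iter_line k.-1 G))%N in
  [/\ perm_eq [seq x <- spectrum R H | 0 < x] (largest_eig R H :: nseq d 1),
      (0 < d)%N,
      largest_eig R H = spectral_radius R H
    & energy R H
      = 2 * largest_eig R H + energy R (iter_line k G) / 2 ].
Proof.
case: k hk hne hrho hmult => // k _; rewrite -pred_Sn.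
rewrite [iter_line k.+1 G]/(line_graph (iter_line k G)).
(* Only the last line graph step matters, so the previous iterate becomes an arbitrary [F]. *)
move: (iter_line k G) => {G k} F hne hrho hmult H d.
have m_gt0 : (0 < graph_size F)%N by rewrite -card_line_graph.
(* A multiplicity is nonnegative, so the integer difference in [hmult] is too, and the truncated
   subtraction in [d] loses nothing. *)
have le_nm : (graph_order F <= graph_size F)%N by lia.
have dE : d = eig_mult (line_graph F) (- 2 : R).
  by move: hmult; rewrite subzn // => -[].
have d_gt0 := line_graph_eigN2_gt0 hrho m_gt0 le_nm.
have ortho := @line_graph_eigN2_orthogonal R F.
rewrite dE; split => //.
- by rewrite (filter_gt0_spectrum_complement hrho ortho d_gt0).
- exact: largest_eig_spectral_radius.
- exact: (energy_complement hrho ortho d_gt0).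
Qed.
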